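(* For all $n\geq0$, the classes $E(\alpha_n)$ and $E(\beta_n)$ belong to $\mathcal{E}$.
   Context: Let $P_0=0$, $P_1=1$, $P_n=2P_{n-1}+P_{n-2}$ (Pell numbers) and $H_0=1$, $H_1=1$, $H_n=2H_{n-1}+H_{n-2}$. For $n\geq0$ let $\alpha_n=2P_{n+1}^2/H_n^2$ if $n$ is even and $\alpha_n=H_{n+1}^2/(2P_n^2)$ if $n$ is odd; let $\beta_n=H_{n+2}/H_n$ if $n$ is even and $\beta_n=P_{n+2}/P_n$ if $n$ is odd. Write $\alpha_n=p_n/q_n$ and $\beta_n=p'_n/q'_n$ in lowest terms. Weight expansion: for rational $a\geq1$ with continued fraction $[l_0;l_1,\dots,l_N]$ ($l_N\geq2$ if $N\geq1$), $w(a)=(1^{\times l_0},x_1^{\times l_1},\dots,x_N^{\times l_N})$ with $x_0=1$, $x_1=a-l_0$, $x_i=x_{i-2}-l_{i-1}x_{i-1}$; $x^{\times l}$ is $x$ repeated $l$ times. Let $W'(\alpha_n)$ be the vector $q_nw(\alpha_n)$ with an extra entry $1$ appended at the end, and $W(\beta_n)=q'_nw(\beta_n)$. Define $E(\alpha_n)=(P_{n+1}H_n,P_{n+1}H_n;W'(\alpha_n))$ for $n$ even, $E(\alpha_n)=(P_nH_{n+1},P_nH_{n+1};W'(\alpha_n))$ for $n$ odd; $E(\beta_n)=\big(\tfrac14(H_n+H_{n+2}),\tfrac14(H_n+H_{n+2});W(\beta_n)\big)$ for $n$ even, $E(\beta_n)=\big(\tfrac14(P_n+P_{n+2})+\tfrac12,\tfrac14(P_n+P_{n+2})-\tfrac12;W(\beta_n)\big)$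 for $n$ odd. (For example $E(\alpha_1)=(3,3;2^{\times4},1^{\times3})$, $E(\beta_3)=(9,8;5^{\times5},4,1^{\times4})$.) The set $\mathcal{E}$: a Cremona transform of an integer tuple $(\delta;n_1,\dots,n_k)$ with $n_1\geq\dots\geq n_k$ is $(2\delta-n_1-n_2-n_3;\delta-n_2-n_3,\delta-n_1-n_3,\delta-n_1-n_2,n_4,\dots,n_k)$; a Cremona move is a Cremona transform followed by a permutation of the entries after the semicolon. $\mathcal{E}$ consists of $(0,0;-1)$ together with all integer tuples $(d,e;m_1,\dots,m_M)$ with $d,e\geq0$, $m_1\geq\dots\geq m_M\geq0$, satisfying $\sum m_i=2(d+e)-1$, $\sum m_i^2=2de+1$, and such that $(d+e-m_1;d-m_1,e-m_1,m_2,\dots,m_M)$ reduces to $(0;-1,0,\dots,0)$ by repeated Cremona moves. *)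

(* Defs.v *)
From mathcomp Require Import all_boot all_order all_algebra.
Set Implicit Arguments. Unset Strict Implicit. Unset Printing Implicit Defensive.
Import Order.TTheory GRing.Theory Num.Theory.
Local Open Scope ring_scope.

Fixpoint pell (n : nat) : nat :=
  match n with
  | 0 => 0
  | 1 => 1
  | (S (S m as k)) => 2 * pell k + pell m
  end%N.

Fixpoint hpell (n : nat) : nat :=
  match n with
  | 0 => 1
  | 1 => 1
  | (S (S m as k)) => 2 * hpell k + hpell m
  end%N.

Definition alpha (n : nat) : rat :=
  if odd n then ((hpell n.+1)%:R ^+ 2) / (2 * (pell n)%:R ^+ 2)
  else (2 * (pell n.+1)%:R ^+ 2) / ((hpell n)%:R ^+ 2).

Definition beta (n : nat) : rat :=
  if odd n then (pell n.+2)%:R / (pell n)%:R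
  else (hpell n.+2)%:R / (hpell n)%:R.

(** Continued fraction [l0; l1, ..., lN] of a positive rational, computed by the
    usual Euclidean algorithm (with enough fuel); the last partial quotient is
    >= 2 when N >= 1. *)
Fixpoint cf_aux (fuel : nat) (x : rat) : seq nat :=
  match fuel with
  | 0 => [::]
  | S f =>
      let l := Num.floor x in
      if x == l%:~R then [:: `|l|%N]
      else `|l|%N :: cf_aux f (x - l%:~R)^-1
  end.

Definition cfrac (a : rat) : seq nat :=
  cf_aux (`|numq a| + `|denq a|).+1 a.

Fixpoint wexp_aux (xprev xcur : rat) (ls : seq nat) : seq rat :=
  match ls with
  | [::] => [::]
  | l :: ls' => nseq l xcur ++ wexp_aux xcur (xprev - l%:R * xcur) ls'
  end.

Definition wexp (a : rat) : seq rat :=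
  match cfrac a with
  | [::] => [::]
  | l0 :: ls => nseq l0 1 ++ wexp_aux 1 (a - l0%:R) ls
  end.

(** A class (d, e; m_1, ..., m_M) with rational entries (for uniformity). *)
Definition rclass := (rat * rat * seq rat)%type.

Definition Wp_alpha (n : nat) : seq rat :=
  [seq (denq (alpha n))%:~R * x | x <- wexp (alpha n)] ++ [:: 1].

Definition W_beta (n : nat) : seq rat :=
  [seq (denq (beta n))%:~R * x | x <- wexp (beta n)].

Definition E_alpha (n : nat) : rclass :=
  let d : rat := if odd n then (pell n * hpell n.+1)%:R
                 else (pell n.+1 * hpell n)%:R in
  (d, d, Wp_alpha n).

Definition E_beta (n : nat) : rclass :=
  if odd n then
    (((pell n)%:R + (pell n.+2)%:R) / 4 + 1 / 2,
     ((pell n)%:R + (pell n.+2)%:R) / 4 - 1 / 2, W_beta n)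
  else
    (((hpell n)%:R + (hpell n.+2)%:R) / 4,
     ((hpell n)%:R + (hpell n.+2)%:R) / 4, W_beta n).

(** Cremona moves on integer tuples (delta; n_1, ..., n_k).
    A Cremona transform is applied to the tuple with entries ordered
    n_1 >= ... >= n_k (k >= 3), and is followed by an arbitrary permutation. *)
Definition cremona_move (t t' : int * seq int) : Prop :=
  exists (n1 n2 n3 : int) (rest : seq int),
    perm_eq [:: n1, n2, n3 & rest] t.2 /\
    sorted (fun x y : int => y <= x) [:: n1, n2, n3 & rest] /\
    t'.1 = 2 * t.1 - n1 - n2 - n3 /\
    perm_eq t'.2 [:: t.1 - n2 - n3, t.1 - n1 - n3, t.1 - n1 - n2 & rest].

Inductive cremona_reach : int * seq int -> int * seq int -> Prop :=
  | cr_refl t : cremona_reach t t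
  | cr_step t u v : cremona_move t u -> cremona_reach u v -> cremona_reach t v.

Definition reduces_to_E (t : int * seq int) : Prop :=
  exists u, cremona_reach t u /\ u.1 = 0 /\
            perm_eq u.2 ((-1) :: nseq (size u.2).-1 0).

Definition in_calE_int (d e : int) (m : seq int) : Prop :=
  (d = 0 /\ e = 0 /\ m = [:: -1]) \/
  (0 <= d /\ 0 <= e /\
   sorted (fun x y : int => y <= x) m /\ all (fun x : int => 0 <= x) m /\
   \sum_(x <- m) x = 2 * (d + e) - 1 /\
   \sum_(x <- m) x ^+ 2 = 2 * d * e + 1 /\
   reduces_to_E (d + e - head 0 m,
                 (d - head 0 m) :: (e - head 0 m) :: behead m)).

Definition in_calE (c : rclass) : Prop :=
  exists (d e : int) (m : seq int),
    c = (d%:~R, e%:~R, [seq x%:~R | x <- m]) /\ in_calE_int d e m.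

(* Main.v *)
(* Up to O(1) terms at the ends and, for alpha_n, in the middle, the continued
   fractions of alpha_n and beta_n are runs of the period (4, 1), so the weights come in groups a^4, b with
   (a, b) = (5a' + b', 4a' + b') for the next group (a', b').  Four Cremona
   moves, on (a, a, a), (a, b, c1), (c2, f, f) and (f, g, g), replace the leading
   part (a^4, b, c1, c2) by (c1', c2') and a residue (4s + r, (5s + r)^4), where
   (s, r) runs through the iterates of the same linear map.  For beta_n there is
   no residue (s = r = 0) and one descends to a trivial tuple.  For alpha_n the
   continued fraction is almost palindromic: the residues accumulated up to the
   middle are exactly the weights still to come, and the process ends with
   (x + y; x, y, w, w, 1), where w is the weight sequence of x / y; on such a
   tuple Cremona moves perform the subtractive Euclidean algorithm on (x, y). *)
Require Import Defs.
From mathcomp Require Import all_boot all_order all_algebra.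
From mathcomp Require Import zify ring lra.
Set Implicit Arguments. Unset Strict Implicit. Unset Printing Implicit Defensive.
Import Order.TTheory GRing.Theory Num.Theory.
Local Open Scope ring_scope.

(* [0 : int] and [1 : int] arise from several structures on [int], but [lia]
   compares the atoms [p 0] and [p 1] syntactically. *)
Ltac unify_constants :=
  repeat match goal with
  | |- context [@Algebra.zero ?T] => change (@Algebra.zero T) with (Posz 0)
  | |- context [@GRing.one ?T] => change (@GRing.one T) with (Posz 1)
  end.

Ltac perm_count :=
  apply/permP => ?; do 2 rewrite /= ?(count_cat, count_nseq) /=;
  unify_constants; lia.

Ltac perm_count_from p :=
  let g := fresh in apply/permP => g; move/permP: p => /(_ g);
  do 2 rewrite /= ?(count_cat, count_nseq) /=; unify_constants; lia.

(** * Reduction by Cremona moves, up to the order of the entries *)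

(** A move sees its input and fixes its output only up to permutation, and so does the terminal
    condition. *)
Lemma reduces_perm (d : int) (m m' : seq int) :
  perm_eq m m' -> reduces_to_E (d, m) -> reduces_to_E (d, m').
Proof.
move=> pm [u [ru [u0 pu]]].
have [t Et] : exists t, t = (d, m) by exists (d, m).
rewrite -Et in ru; case: ru Et u0 pu => [{}t -> /= d0 pt|{}t u1 v mv rv Et].
  exists (d, m'); split; first exact: cr_refl.
  by split=> //=; rewrite -(perm_size pm) -(permPl pm).
move=> v0 pv; exists v; split=> //.
apply: cr_step rv; move: mv; rewrite Et => -[n1 [n2 [n3 [rest /= [p [s e]]]]]].
by exists n1, n2, n3, rest; rewrite (permPl p).
Qed.

(** Only the three largest entries need to be exhibited; sorting the others is hidden in the
    proof. *)
Lemma reduces_step (d n1 n2 n3 : int) (rest : seq int) :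
  n2 <= n1 -> n3 <= n2 -> all (fun x => x <= n3) rest ->
  reduces_to_E (2 * d - n1 - n2 - n3,
    [:: d - n2 - n3, d - n1 - n3, d - n1 - n2 & rest]) ->
  reduces_to_E (d, [:: n1, n2, n3 & rest]).
Proof.
move=> h12 h23 hr [u [ru hu]]; exists u; split=> //.
apply: cr_step ru.
have ge_total : total (fun x y : int => y <= x) by move=> x y; exact: le_total.
have ge_trans : transitive (fun x y : int => y <= x).
  by move=> y x z xy yz; exact: le_trans yz xy.
exists n1, n2, n3, (sort (fun x y : int => y <= x) rest); split=> /=.
  by rewrite !perm_cons perm_sort.
split; last by split=> //; rewrite !perm_cons perm_sym perm_sort.
rewrite h12 h23 /= path_min_sorted ?sort_sorted //.
by rewrite all_sort.
Qed.

(** * Weight expansions over the integers *)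

(* [cf_weights ls x y w] : [x / y] is in lowest terms with partial quotients [ls],
   and [w] is [y] times its weight expansion.  A last quotient 1 is allowed. *)
Inductive cf_weights : seq nat -> int -> int -> seq int -> Prop :=
| CfNil : cf_weights [::] 1 0 [::]
| CfCons l ls x y w : (0 < l)%N -> cf_weights ls x y w ->
    cf_weights (l :: ls) (l%:Z * x + y) x (nseq l x ++ w).

Lemma cf_weights_bounds ls x y w : cf_weights ls x y w ->
  [/\ 0 <= y, y <= x, 1 <= x & all (fun t => (1 <= t) && (t <= y)) w].
Proof.
elim=> [//|l {}ls {}x {}y {}w l0 _ [y0 yx x1 hw]]; split=> //; try nia.
rewrite all_cat all_nseq; apply/andP; split; first by apply/orP; right; lia.
by apply: sub_all hw => t; lia.
Qed.

(** Each quotient raises [x + y] by [l * x >= 1]; this shows that the fuel of [cfrac] suffices. *)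
Lemma cf_weights_size ls x y w : cf_weights ls x y w -> (size ls)%:Z < x + y.
Proof.
by elim=> [//|l {}ls {}x {}y {}w l0 /cf_weights_bounds [y0 yx x1 _] /=]; nia.
Qed.

Lemma cf_weights_sorted ls x y w k : cf_weights ls x y w ->
  sorted (fun x y : int => y <= x) (w ++ nseq k 1).
Proof.
elim=> [|l {}ls {}x {}y {}w l0 /cf_weights_bounds [y0 yx x1 hw] sw].
  by elim: k => [//|k IH]; rewrite /= path_min_sorted // all_nseq lexx orbT.
elim: l {l0} => [//|l IH] /=; rewrite path_min_sorted //.
rewrite !all_cat !all_nseq lexx x1 !orbT andbT /=.
by apply: sub_all hw => t; lia.
Qed.

Lemma cf_weights_sum ls x y w : cf_weights ls x y w -> \sum_(t <- w) t = x + y - 1.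
Proof.
elim=> [|l {}ls {}x {}y {}w l0 _ IH]; first by rewrite big_nil.
rewrite big_cat /= IH big_nseq iter_addr_0 -mulr_natr; lia.
Qed.

(** The weights are the sides of the squares that tile an [x] by [y] rectangle greedily. *)
Lemma cf_weights_sum_sqr ls x y w : cf_weights ls x y w ->
  \sum_(t <- w) t ^+ 2 = x * y.
Proof.
elim=> [|l {}ls {}x {}y {}w l0 _ IH]; first by rewrite big_nil.
rewrite big_cat /= IH big_nseq iter_addr_0 -mulr_natr; lia.
Qed.

Lemma cf_weights_coprime ls x y w : cf_weights ls x y w -> coprimez x y.
Proof.
elim=> [//|l {}ls {}x {}y {}w l0 _ IH].
by rewrite /coprimez gcdzC gcdzMDl.
Qed.

Lemma cf_weights_strict ls x y w : cf_weights ls x y w -> ls != [::] ->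
  (1 < last 2 ls)%N -> 0 < y < x.
Proof.
move=> C; elim: C => [//|l {}ls {}x {}y {}w l0 C IH] _ /= hl.
have [y0 yx x1 _] := cf_weights_bounds C.
case: C IH hl => [|l' ls' x' y' w' l0' C'] IH /= hl; first by nia.
by have := IH isT hl; nia.
Qed.

Lemma cf_auxE ls x y w fuel : cf_weights ls x y w -> ls != [::] ->
  (1 < last 2 ls)%N -> (size ls <= fuel)%N ->
  cf_aux fuel (x%:~R / y%:~R) = ls.
Proof.
move=> C; elim: C fuel => [//|l {}ls {}x {}y {}w l0 C IH] [//|fuel] _ hl /= hf.
have [y0 yx x1 _] := cf_weights_bounds C.
have x0Q : (x%:~R : rat) != 0 by rewrite intr_eq0; lia.
have E : ((l%:Z * x + y)%:~R / x%:~R : rat) = l%:Z%:~R + y%:~R / x%:~R.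
  by rewrite intrD intrM mulrDl mulfK.
case: (eqVneq ls [::]) C IH hl hf => [-> C _ _ _|lsN C IH hl hf].
  have y00 : y = 0 by inversion C.
  by rewrite E y00 mul0r addr0 intrKfloor eqxx absz_nat.
have hl' : (1 < last 2 ls)%N by case: (ls) lsN hl.
(* Strictness puts [y / x] strictly between 0 and 1, so [l] is the floor and the integrality test of
   [cf_aux] fails. *)
have /andP[yp yx'] := cf_weights_strict C lsN hl'.
have F : Num.floor (l%:Z%:~R + y%:~R / x%:~R : rat) = l%:Z.
  apply: floor_def; rewrite intrD lerDl ltrD2l divr_ge0 ?ler0z //=; last lia.
  by rewrite ltr_pdivrMr ?ltr0z ?mul1r ?ltr_int //; lia.
rewrite E F -subr_eq0 addrC addKr mulf_eq0 invr_eq0 (negPf x0Q) orbF.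
rewrite intr_eq0 gt_eqF // absz_nat invf_div.
by rewrite IH.
Qed.

Lemma cf_weights_denq ls x y w : cf_weights ls x y w -> 0 < y ->
  denq (x%:~R / y%:~R) = y.
Proof.
move=> /cf_weights_coprime C y0; rewrite coprimeq_den; last by rewrite -coprimezE.
by rewrite gt_eqF //; lia.
Qed.

Lemma cf_weights_cfrac ls x y w : cf_weights ls x y w -> ls != [::] ->
  (1 < last 2 ls)%N -> cfrac (x%:~R / y%:~R) = ls.
Proof.
move=> C lsN hl; have /andP[y0 yx] := cf_weights_strict C lsN hl.
apply: (cf_auxE C) => //.
have CO := cf_weights_coprime C.
rewrite coprimeq_num -?coprimezE // (cf_weights_denq C y0) gtr0_sg // mul1r.
by have := cf_weights_size C; lia.
Qed.

Lemma wexp_auxE ls x y w (q : rat) : cf_weights ls x y w ->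
  wexp_aux (x%:~R / q) (y%:~R / q) ls = [seq t%:~R / q | t <- w].
Proof.
elim=> [//|l {}ls {}x {}y {}w l0 _ IH] /=.
rewrite map_cat map_nseq -IH; congr (_ ++ wexp_aux _ _ _).
by rewrite intrD intrM -pmulrn; ring.
Qed.

(** The bridge from the rational definition of the weights to the integer recursion used from here
    on. *)
Lemma cf_weights_wexp ls x y w : cf_weights ls x y w -> ls != [::] ->
  (1 < last 2 ls)%N ->
  [seq (denq (x%:~R / y%:~R))%:~R * t | t <- wexp (x%:~R / y%:~R)]
  = [seq t%:~R | t <- w].
Proof.
move=> C lsN hl; have /andP[y0 yx] := cf_weights_strict C lsN hl.
have y0Q : (y%:~R : rat) != 0 by rewrite intr_eq0; lia.
rewrite (cf_weights_denq C y0) /wexp (cf_weights_cfrac C lsN hl).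
have := wexp_auxE (y%:~R) C.
case: ls lsN {hl C} => [//|l ls] _ /=; rewrite divff // mulr1 => ->.
by rewrite -map_comp; apply: eq_map => t /=; rewrite mulrC divfK.
Qed.

(** * The Euclidean reduction and the block of four moves *)

Lemma cf_weights_reduces ls x y w z : cf_weights ls x y w ->
  all (fun t => t == 0) z -> reduces_to_E (x + y, [:: x, y, 1 & w ++ w ++ z]).
Proof.
move=> C; elim: C z => [|l {}ls {}x {}y {}w l0 C IH] z z0.
  apply: (@reduces_perm _ [:: 1 : int, 1, 0 : int & z]); first perm_count.
  apply: reduces_step => //; first by apply: sub_all z0 => t /eqP ->.
  rewrite /=; eexists; split; first exact: cr_refl.
  split=> //=; move/all_pred1P: z0 => ->.
  by rewrite size_nseq; exact/permPl/(perm_catCA [:: 0; 0] [:: -1]).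
have [y0 yx x1 hw] := cf_weights_bounds C.
elim: l l0 z z0 => [//|l IHl] _ z z0.
(* One subtraction: the old second entry and one copy of [x] become zeros, collected in [z], and the
   other copy becomes the second entry. Once [l] copies are used up, the two leading entries
   exchange roles. *)
apply: (@reduces_perm _ [:: l.+1%:Z * x + y, x, x
  & x :: 1 :: nseq l x ++ nseq l x ++ w ++ w ++ z]).
  perm_count.
apply: reduces_step => //; first nia.
  rewrite /= !all_cat !all_nseq lexx !orbT x1 /=.
  have hw' : all (fun t => t <= x) w by apply: sub_all hw => t; lia.
  by rewrite hw' /=; apply: sub_all z0 => t /eqP ->; lia.
have -> : 2 * (l.+1%:Z * x + y + x) - (l.+1%:Z * x + y) - x - x
   = l%:Z * x + y + x by rewrite intS; ring.
have -> : l.+1%:Z * x + y + x - x - x = l%:Z * x + y by rewrite intS; ring.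
have -> : l.+1%:Z * x + y + x - (l.+1%:Z * x + y) - x = 0 by ring.
case: l IHl => [_|l IHl].
  rewrite mul0r add0r [y + x]addrC.
  by apply: reduces_perm (IH [:: 0, 0 & z] _) => //; perm_count.
by apply: reduces_perm (IHl isT [:: 0, 0 & z] _) => //; perm_count.
Qed.

(** [d1] is the degree after the first move, which produces [f] three times; [g] comes from both the
    second and the third move; [u] and the four [z] form the residue. The inequalities keep the
    entries of each move on top. *)
Lemma reduces_block (d a b c1 c2 : int) (R : seq int) :
  let d1 : int := 2 * d - 3 * a in let f : int := d - 2 * a in
  let g : int := d1 - b - c1 in let u : int := d1 - a - b in
  let z : int := 3 * d - 5 * a - b - c1 - c2 in
  b <= a -> c1 <= b -> c2 <= c1 -> f <= c2 -> g <= f ->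
  d1 - a - c1 <= g -> u <= g -> z <= g -> all (fun t => t <= g) R ->
  reduces_to_E (7 * d - 12 * a - 2 * b - 2 * c1 - 2 * c2,
    d1 - a - c2 :: d1 - a - c1 :: u :: nseq 4 z ++ R) ->
  reduces_to_E (d, nseq 4 a ++ b :: c1 :: c2 :: R).
Proof.
move=> d1 f g u z ba cb c21 fc gf h1 h2 h3 hR H.
have hR' v : g <= v -> all (fun t => t <= v) R.
  by move=> gv; apply: sub_all hR => t; lia.
rewrite /=; apply: reduces_step => //=; first by rewrite hR' /=; lia.
apply: (@reduces_perm _ [:: a, b, c1, c2, f, f, f & R]).
  have -> : f = d - a - a by lia.
  perm_count.
apply: reduces_step => //=; first by rewrite hR' /=; lia.
have -> : 2 * d - a - a - a = d1 by lia.
rewrite -/g -/u.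
apply: (@reduces_perm _ [:: c2, f, f, f, g, d1 - a - c1, u & R]); first perm_count.
apply: reduces_step => //=; first by rewrite hR' /=; lia.
set d2 : int := 2 * d1 - a - b - c1.
have -> : d2 - f - f = g by lia.
have -> : d2 - c2 - f = z by lia.
apply: (@reduces_perm _ [:: f, g, g, d1 - a - c1, u, z, z & R]); first perm_count.
apply: reduces_step => //=; first by rewrite hR' /=; lia.
set d3 : int := 2 * d2 - c2 - f - f.
have -> : d3 - g - g = d1 - a - c2 by lia.
have -> : d3 - f - g = z by lia.
have -> : 2 * d3 - f - g - g = 7 * d - 12 * a - 2 * b - 2 * c1 - 2 * c2 by lia.
by apply: reduces_perm H; perm_count.
Qed.

(** * Runs of the period (1, 4) and chains of blocks *)

(* Prepending the partial quotients 1, 4 to those of [x / y]. *)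
Definition cf14 (t : int * int * seq int) : int * int * seq int :=
  let: (x, y, w) := t in
  (5 * x + y, 4 * x + y, 4 * x + y :: nseq 4 x ++ w).

(** The linear map on pairs is that of [cf14], but the entry recorded four times is the new first
    coordinate, not the old one. *)
Definition residue14 (t : int * int * seq int) : int * int * seq int :=
  let: (s, r, X) := t in
  (5 * s + r, 4 * s + r, 4 * s + r :: nseq 4 (5 * s + r) ++ X).

Lemma cf_weights_cons l ls x y w p w' : (0 < l)%N -> cf_weights ls x y w ->
  p = l%:Z * x + y -> w' = nseq l x ++ w -> cf_weights (l :: ls) p x w'.
Proof. by move=> l0 C -> ->; exact: CfCons. Qed.

Lemma cf_weights_cf14 k ls x0 y0 w0 x y w : cf_weights ls x0 y0 w0 ->
  iter k cf14 (x0, y0, w0) = (x, y, w) ->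
  cf_weights (iter k (fun l => [:: 1, 4 & l]%N) ls) x y w.
Proof.
move=> C; elim: k x y w => [|k IH] x y w; first by case=> <- <- <-.
rewrite !iterS; case: (iter k cf14 _) IH => [[x1 y1] w1] /(_ _ _ _ erefl) C1.
case=> <- <- <-.
have C2 : cf_weights (4%N :: iter k (fun l => [:: 1, 4 & l]%N) ls)
  (4 * x1 + y1) x1 (nseq 4 x1 ++ w1) by exact: cf_weights_cons C1 _ _.
by apply: cf_weights_cons C2 _ _ => //; lia.
Qed.

Lemma cf14_bounds k x0 y0 w0 x y w : 0 <= y0 -> y0 <= x0 ->
  all (fun t => t <= x0) w0 -> iter k cf14 (x0, y0, w0) = (x, y, w) ->
  [/\ 0 <= y, y <= x, x0 <= x & all (fun t => t <= x) w].
Proof.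
move=> y00 yx0 hw0; elim: k x y w => [|k IH] x y w; first by case=> <- <- <-.
rewrite !iterS; case: (iter k cf14 _) IH => [[x1 y1] w1].
move=> /(_ _ _ _ erefl) [y1p yx1 xx1 hw1] [<- <- <-]; split; try lia.
have hw : all (fun t => t <= 5 * x1 + y1) w1.
  by apply: sub_all hw1 => t; lia.
by rewrite /= hw; lia.
Qed.

Lemma residue14_bounds k s0 r0 X0 s r X : 0 <= s0 -> 0 <= r0 ->
  iter k residue14 (s0, r0, X0) = (s, r, X) -> s0 <= s /\ r0 <= r.
Proof.
move=> s00 r00; elim: k s r X => [|k IH] s r X; first by case=> <- <- _.
rewrite !iterS; case: (iter k residue14 _) IH => [[s1 r1] X1].
by move=> /(_ _ _ _ erefl) [s1p r1p] [<- <- _]; split; lia.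
Qed.

(* A block turns [c1] into [2 d - 4 a - c2] and [c2] into [2 d - 4 a - c1]; this
   preserves [c1 - c2], and the relation between [c1 + c2] and [x, y, s, r]. *)
Lemma reduces_chain k x0 y0 w0 x y w s r X s' r' X' c1 c2 :
  1 <= x0 -> 0 <= y0 -> y0 <= x0 -> all (fun t => t <= x0) w0 ->
  0 <= s -> 0 <= r -> all (fun t => t <= s + r) X ->
  iter k cf14 (x0, y0, w0) = (x, y, w) ->
  iter k residue14 (s, r, X) = (s', r', X') ->
  9 * (s' + r') <= x0 ->
  c2 <= c1 -> c1 <= c2 + 1 -> 2 * (c1 + c2) = 2 * x + y + 2 * s + r ->
  (forall d1 d2, d1 - d2 = c1 - c2 ->
     2 * (d1 + d2) = 2 * x0 + y0 + 2 * s' + r' ->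
     reduces_to_E (d1 + d2 + x0 + s', nseq 4 x0 ++ w0 ++ d1 :: d2 :: X')) ->
  reduces_to_E (c1 + c2 + x + s, nseq 4 x ++ w ++ c1 :: c2 :: X).
Proof.
move=> x01 y00 yx0 hw0.
elim: k x y w s r X c1 c2 => [|k IH] x y w s r X c1 c2 s0 r0 hX.
  move=> [<- <- <-] [<- <- <-] xs c21 c12 cE H.
  exact: H.
(* Weights are consumed from the outermost iterate inwards, whereas residues grow from the innermost
   one. *)
rewrite iterS iterSr; case E: (iter k cf14 _) => [[x1 y1] w1] [<- <- <-].
move=> Er xs c21 c12 cE H.
have [y1p yx1 xx1 hw1] := cf14_bounds y00 yx0 hw0 E.
(* Residues increase along the chain, so [xs] keeps all of them small against the weights still
   present. *)
have [ss rr] : 5 * s + r <= s' /\ 4 * s + r <= r'.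
  by apply: residue14_bounds Er; lia.
set a : int := 5 * x1 + y1; set b : int := 4 * x1 + y1.
set d : int := c1 + c2 + a + s.
set e1 : int := 2 * d - 3 * a - a - c2; set e2 : int := 2 * d - 3 * a - a - c1.
have red' : reduces_to_E (e1 + e2 + x1 + (5 * s + r),
    nseq 4 x1 ++ w1 ++ e1 :: e2 :: 4 * s + r :: nseq 4 (5 * s + r) ++ X).
  apply: (IH _ _ _ (5 * s + r) (4 * s + r)) (E) (Er) xs _ _ _ _; try lia.
    have hX' : all (fun t => t <= 5 * s + r + (4 * s + r)) X.
      by apply: sub_all hX => t; lia.
    by rewrite /= hX'; lia.
  move=> d1 d2 dd dE; apply: H => //; lia.
apply: (@reduces_perm _ (nseq 4 a ++ b :: c1 :: c2 :: nseq 4 x1 ++ w1 ++ X)).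
  perm_count.
apply: reduces_block; try lia.
  have hX' v : s + r <= v -> all (fun t => t <= v) X.
    by move=> gv; apply: sub_all hX => t; lia.
  have hw' v : x1 <= v -> all (fun t => t <= v) w1.
    by move=> gv; apply: sub_all hw1 => t; lia.
  by rewrite !all_cat hX' ?hw' /=; lia.
rewrite -/e1 -/e2.
have -> : 2 * d - 3 * a - a - b = 4 * s + r by lia.
have -> : 3 * d - 5 * a - b - c1 - c2 = 5 * s + r by lia.
have -> : 7 * d - 12 * a - 2 * b - 2 * c1 - 2 * c2 = e1 + e2 + x1 + (5 * s + r).
  by lia.
by apply: reduces_perm red'; perm_count.
Qed.

(** Since (6, 5) is two steps after (0, 1), [(x, y)] stays two residue steps ahead of [(s, r)].
    Hence the residue added at each step consists of weights of the other side. *)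
Lemma cf14_residue14_perm k s r X x y w :
  iter k residue14 (0, 1, [:: 1]) = (s, r, X) ->
  iter k cf14 (6, 5, [:: 5, 1 & nseq 4 1]) = (x, y, w) ->
  [/\ x = 5 * (5 * s + r) + (4 * s + r), y = 4 * (5 * s + r) + (4 * s + r) &
   perm_eq [:: y, 4 * s + r & nseq 4 (5 * s + r) ++ X] (1 :: w)].
Proof.
elim: k s r X x y w => [|k IH] s r X x y w.
  by case=> <- <- <- [<- <- <-].
rewrite !iterS; case: (iter k residue14 _) IH => [[s1 r1] X1].
case: (iter k cf14 _) => [[x1 y1] w1] /(_ _ _ _ _ _ _ erefl erefl) [-> -> p].
case=> <- <- <- [<- <- <-]; split=> //.
perm_count_from p.
Qed.

Lemma residue14_zero k s r X : iter k residue14 (0, 0, [::]) = (s, r, X) ->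
  [/\ s = 0, r = 0 & all (fun t => t == 0) X].
Proof.
elim: k s r X => [|k IH] s r X; first by case=> <- <- <-.
rewrite iterS; case: (iter k residue14 _) IH => [[s1 r1] X1].
by move=> /(_ _ _ _ erefl) [-> -> X0] [<- <- <-]; split=> //=.
Qed.

(** * The middle of the expansion of alpha_n *)

(** Treats the middle quotients 1, 1, 3. Four moves lead to the Euclidean tuple of [(s + r) / s],
    whose weights are [s :: w]. *)
Lemma reduces_even_end ls s r w X : cf_weights ls s r w ->
  perm_eq (r :: X) (1 :: w) ->
  reduces_to_E (16 * s + 5 * r, nseq 4 (7 * s + 2 * r) ++
    ([:: 4 * s + r, 3 * s + r, s, s, s & w]) ++
    4 * s + 2 * r :: 4 * s + 2 * r :: X).
Proof.
move=> C p; have [r0 rs s1 hw] := cf_weights_bounds C.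
have hw' v : r <= v -> all (fun t => t <= v) w.
  by move=> rv; apply: sub_all hw => t; lia.
have hX v : s <= v -> all (fun t => t <= v) X.
  move=> sv; have : all (fun t => t <= v) (r :: X).
    by rewrite (perm_all _ p) /= hw'; lia.
  by case/andP.
set a : int := 7 * s + 2 * r; set b1 : int := 4 * s + r; set b2 : int := 3 * s + r.
set c : int := 4 * s + 2 * r.
apply: (@reduces_perm _ [:: a, a, a, a, b1, b2, c, c, s, s, s & w ++ X]).
  perm_count.
apply: reduces_step; [lia|lia|rewrite /= all_cat hw' ?hX; lia|].
have -> : 16 * s + 5 * r - a - a = 2 * s + r by lia.
have -> : 2 * (16 * s + 5 * r) - a - a - a = 11 * s + 4 * r by lia.
set f : int := 2 * s + r.
apply: (@reduces_perm _ [:: a, c, c, b1, b2, f, f, f, s, s, s & w ++ X]).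
  perm_count.
apply: reduces_step; [lia|lia|rewrite /= all_cat hw' ?hX; lia|].
have -> : 11 * s + 4 * r - c - c = 3 * s by lia.
have -> : 11 * s + 4 * r - a - c = 0 by lia.
have -> : 2 * (11 * s + 4 * r) - a - c - c = a by lia.
apply: (@reduces_perm _ [:: b1, b2, 3 * s, f, f, f, s, s, s, 0, 0 & w ++ X]).
  perm_count.
apply: reduces_step; [lia|lia|rewrite /= all_cat hw' ?hX; lia|].
have -> : a - b2 - 3 * s = s + r by lia.
have -> : a - b1 - 3 * s = r by lia.
have -> : a - b1 - b2 = 0 by lia.
have -> : 2 * a - b1 - b2 - 3 * s = b1 + r by lia.
apply: (@reduces_perm _ [:: f, f, f, s + r, r, 0, s, s, s, 0, 0 & w ++ X]).
  perm_count.
apply: reduces_step; [lia|lia|rewrite /= all_cat hw' ?hX; lia|].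
have -> : b1 + r - f - f = 0 by lia.
have -> : 2 * (b1 + r) - f - f - f = s + r + s by lia.
have C' : cf_weights (1%N :: ls) (s + r) s (s :: w).
  by apply: cf_weights_cons C _ _ => //; lia.
apply: reduces_perm (cf_weights_reduces (z := nseq 6 0) C' isT).
perm_count_from p.
Qed.

(** Treats the middle quotients 1, 3, 1. After one block, a move on three copies of [x + y] leaves
    [x], [y], [y], [w] and the residues; by the last hypothesis one [y] and the residues amount to
    [1 :: w]. *)
Lemma reduces_odd_end ls s r x y w X : 0 <= s -> 0 <= r ->
  x = 5 * (5 * s + r) + (4 * s + r) -> y = 4 * (5 * s + r) + (4 * s + r) ->
  cf_weights ls x y w ->
  perm_eq [:: y, 4 * s + r & nseq 4 (5 * s + r) ++ X] (1 :: w) ->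
  reduces_to_E (578 * s + 120 * r, nseq 4 (5 * x + 4 * y) ++
    ([:: 4 * x + 3 * y, x + y, x + y, x + y, x & w]) ++
    168 * s + 35 * r :: 168 * s + 35 * r :: X).
Proof.
move=> s0 r0 xE yE C p; have [y0 yx x1 hw] := cf_weights_bounds C.
have hw' v : y <= v -> all (fun t => t <= v) w.
  by move=> rv; apply: sub_all hw => t; lia.
have hX v : x <= v -> all (fun t => t <= v) X.
  move=> sv.
  have : all (fun t => t <= v) [:: y, 4 * s + r & nseq 4 (5 * s + r) ++ X].
    by rewrite (perm_all _ p) /= hw'; lia.
  by rewrite /= => /and5P[_ _ _ _ /and3P[]].
set c : int := 168 * s + 35 * r; set d : int := 578 * s + 120 * r.
set a : int := 5 * x + 4 * y; set b : int := 4 * x + 3 * y.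
apply: (@reduces_perm _ (nseq 4 a ++
  [:: b, c, c, x + y, x + y, x + y, x & w ++ X])).
  perm_count.
apply: reduces_block; try lia.
  by rewrite /= all_cat hw' ?hX; lia.
have -> : 2 * d - 3 * a - a - c = y by lia.
have -> : 2 * d - 3 * a - a - b = 4 * s + r by lia.
have -> : 3 * d - 5 * a - b - c - c = 5 * s + r by lia.
have -> : 7 * d - 12 * a - 2 * b - 2 * c - 2 * c = (x + y) + (x + y) by lia.
apply: (@reduces_perm _ ([:: x + y, x + y, x + y, x, y, y & w ++
  (4 * s + r) :: nseq 4 (5 * s + r) ++ X])).
  perm_count.
apply: reduces_step; [lia|lia| |].
  by rewrite /= !all_cat hw' /= ?hX; lia.
have -> : x + y + (x + y) - (x + y) - (x + y) = 0 by lia.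
have -> : 2 * (x + y + (x + y)) - (x + y) - (x + y) - (x + y) = x + y by lia.
apply: reduces_perm (cf_weights_reduces (z := nseq 3 0) C isT).
perm_count_from p.
Qed.

(** * Pell numbers and the iterated linear map *)

Lemma pellSS m : pell m.+2 = (2 * pell m.+1 + pell m)%N.
Proof. by []. Qed.

Lemma hpellSS m : hpell m.+2 = (2 * hpell m.+1 + hpell m)%N.
Proof. by []. Qed.

(* [s] and [r] are P_{2k} / 2 and P_{2k-1}; for k = 0 the latter is 1. *)
Lemma pell_coordinates k : exists s r : int,
  [/\ 0 <= s, 0 <= r & r ^+ 2 + 4 * r * s - 4 * s ^+ 2 = 1] /\
  [/\ (pell k.*2)%:Z = 2 * s, (pell k.*2.+1)%:Z = 4 * s + r,
   (hpell k.*2)%:Z = 2 * s + r & (hpell k.*2.+1)%:Z = 6 * s + r] /\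
  (forall x y w, exists w',
     iter k cf14 (x, y, w) = (x * (4 * s + r) + y * s, 4 * s * x + r * y, w')) /\
  (forall x y X, exists X',
     iter k residue14 (x, y, X) =
     (x * (4 * s + r) + y * s, 4 * s * x + r * y, X')).
Proof.
(* The k-th power of the matrix with rows (5, 1) and (4, 1) has rows [(4 * s + r, s)] and
   [(4 * s, r)]; [det] says that its determinant is 1. *)
elim: k => [|k [s [r [[s0 r0 det] [[p0 p1 h0 h1] [Hw HX]]]]]].
  exists 0, 1; split=> //; split=> //.
  by split=> x y w; exists w => /=; congr (_, _, _); lia.
exists (5 * s + r), (4 * s + r); split; first by split; lia.
split; first by rewrite doubleS !(pellSS, hpellSS); split; lia.
split=> x y w.
  have [w' E] := Hw x y w; rewrite iterS E /=.
  by eexists; congr (_, _, _); lia.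
have [X' E] := HX x y w; rewrite iterS E /=.
by eexists; congr (_, _, _); lia.
Qed.

(** * Membership criteria *)

(** Here [k] counts the appended ones: 1 for alpha_n, 0 for beta_n. The block [nseq l.+1 q] exposes
    the largest entry, which the passage to the Cremona tuple removes. *)
Lemma in_calE_weights ls (p q d e : int) w1 l k :
  cf_weights ls p q (nseq l.+1 q ++ w1) ->
  0 <= d -> 0 <= e -> p + q + k%:Z = 2 * (d + e) -> p * q + k%:Z = 2 * d * e + 1 ->
  reduces_to_E (d + e - q, [:: d - q, e - q & nseq l q ++ w1 ++ nseq k 1]) ->
  in_calE (d%:~R, e%:~R,
    [seq t%:~R | t <- nseq l.+1 q ++ w1] ++ nseq k 1).
Proof.
move=> C d0 e0 sum1 sum2 red.
exists d, e, ((nseq l.+1 q ++ w1) ++ nseq k 1); split.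
  by rewrite [in RHS]map_cat map_nseq.
right; do 2![split=> //].
split; first exact: (cf_weights_sorted _ C).
have [_ _ _ hw] := cf_weights_bounds C.
split.
  rewrite all_cat all_nseq orbT andbT.
  by apply: sub_all hw => t; lia.
split; first by rewrite big_cat /= (cf_weights_sum C) big_nseq iter_addr_0; lia.
split; last by rewrite /= -catA.
by rewrite big_cat /= (cf_weights_sum_sqr C) big_nseq iter_addr_0 expr1n; lia.
Qed.

Lemma in_calE_alpha n ls (p q d : int) w l :
  cf_weights ls p q (nseq l.+1 q ++ w) -> ls != [::] -> (1 < last 2 ls)%N ->
  alpha n = p%:~R / q%:~R ->
  (if odd n then pell n * hpell n.+1 else pell n.+1 * hpell n)%N = d :> int ->
  p + q + 1 = 4 * d -> p * q = 2 * d ^+ 2 ->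
  reduces_to_E (2 * d - q, [:: d - q, d - q & nseq l q ++ w ++ [:: 1]]) ->
  in_calE (E_alpha n).
Proof.
move=> C lsN hl aE dE s1 s2 red.
have d0 : 0 <= d by rewrite -dE; lia.
have -> : E_alpha n =
    (d%:~R, d%:~R, [seq t%:~R | t <- nseq l.+1 q ++ w] ++ nseq 1 1).
  rewrite /E_alpha /Wp_alpha aE (cf_weights_wexp C lsN hl) -dE.
  by case: (odd n); rewrite -pmulrn.
apply: (in_calE_weights C) => //; try lia.
by have -> : d + d - q = 2 * d - q by lia.
Qed.

Lemma in_calE_beta n ls (p q d e : int) w l :
  cf_weights ls p q (nseq l.+1 q ++ w) -> ls != [::] -> (1 < last 2 ls)%N ->
  beta n = p%:~R / q%:~R -> 0 <= d -> 0 <= e ->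
  p + q = 2 * (d + e) -> d - e = odd n -> p * q = 2 * d * e + 1 ->
  (if odd n then pell n.+2 else hpell n.+2) = p :> int ->
  (if odd n then pell n else hpell n) = q :> int ->
  reduces_to_E (d + e - q, [:: d - q, e - q & nseq l q ++ w]) ->
  in_calE (E_beta n).
Proof.
move=> C lsN hl bE d0 e0 s1 de s2 pE qE red.
have -> : E_beta n =
    (d%:~R, e%:~R, [seq t%:~R | t <- nseq l.+1 q ++ w] ++ nseq 0 1).
  rewrite /E_beta /W_beta bE (cf_weights_wexp C lsN hl) cats0.
  have s1Q : p%:~R + q%:~R = 2 * (d%:~R + e%:~R) :> rat.
    by rewrite -!intrD s1 intrM.
  have deQ : d%:~R - e%:~R = (odd n)%:R :> rat.
    by rewrite -intrB de -pmulrn.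
  have nQ (m : nat) (t : int) : m = t :> int -> m%:R = t%:~R :> rat.
    by move=> <-; rewrite -pmulrn.
  by case: (odd n) pE qE deQ => /nQ -> /nQ -> /= deQ; congr (_, _, _); lra.
apply: (in_calE_weights C) => //; try lia.
by rewrite cats0.
Qed.

Lemma last_iter_cf14 k ls (l0 : nat) : ls != [::] ->
  last l0 (iter k (fun l => [:: 1, 4 & l]%N) ls) = last l0 ls.
Proof.
move=> lsN; have lastE m m' : last m ls = last m' ls by case: ls lsN.
elim: k l0 => [//|k IH] l0; rewrite iterS /= IH; exact: lastE.
Qed.

(** The default 5 is the leading quotient of beta_{2k+1}, which is also the last one when
    [k = 0]. *)
Lemma last_iter_cf14_nil k :
  last 5%N (iter k (fun l => [:: 1, 4 & l]%N) [::]) = (if k is 0 then 5 else 4)%N.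
Proof. by case: k => // k; rewrite iterSr last_iter_cf14. Qed.

(** * The four families *)

(* alpha_{2k+3} = [5; (1, 4)^k, 1, 3, 1, (1, 4)^k, 1, 5]. *)
Lemma in_calE_alpha_odd k : in_calE (E_alpha k.*2.+3).
Proof.
have [s [r [[s0 r0 det] [[p0 p1 h0 h1] [Hw HX]]]]] := pell_coordinates k.
have [w Ew] := Hw 6 5 [:: 5, 1 & nseq 4 1].
(* The entry 1 is the one appended to the weights; [r = 1] accounts for it in [cE]. *)
have [X {}HX] := HX 0 1 [:: 1].
have EX : iter k residue14 (0, 1, [:: 1]) = (s, r, X).
  by rewrite HX; congr (_, _, _); lia.
have [] := cf14_residue14_perm EX Ew.
(* [S / Q] is the part [(1, 4)^k, 1, 5] that follows the middle. *)
move: Ew; set S := _ + 5 * s; set Q := _ + r * 5 => Ew SE QE pX.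
have C0 : cf_weights [:: 1; 5]%N 6 5 [:: 5, 1 & nseq 4 1].
  exact: (CfCons (l := 1) isT (CfCons (l := 5) isT CfNil)).
have C1 := cf_weights_cf14 C0 Ew.
have C2 : cf_weights [:: 1, 3, 1 & iter k (fun l => [:: 1, 4 & l]%N) [:: 1; 5]%N]
    (5 * S + 4 * Q) (4 * S + 3 * Q)
    ([:: 4 * S + 3 * Q, S + Q, S + Q, S + Q, S & w]).
  have C3 : cf_weights (1%N :: iter k (fun l => [:: 1, 4 & l]%N) [:: 1; 5]%N)
    (S + Q) S (S :: w) by apply: cf_weights_cons C1 _ _ => //; lia.
  have C4 : cf_weights [:: 3, 1 & iter k (fun l => [:: 1, 4 & l]%N) [:: 1; 5]%N]
    (4 * S + 3 * Q) (S + Q) (nseq 3 (S + Q) ++ S :: w).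
    by apply: cf_weights_cons C3 _ _ => //; lia.
  by apply: cf_weights_cons C4 _ _ => //; lia.
have [w2 E2] := Hw (5 * S + 4 * Q) (4 * S + 3 * Q)
  [:: 4 * S + 3 * Q, S + Q, S + Q, S + Q, S & w].
move: E2; set x := _ + _ * s; set y := _ + r * _ => E2.
have C3 := cf_weights_cf14 C2 E2.
set ls := iter k _ _ in C3.
have C4 : cf_weights (5%N :: ls) (5 * x + y) x (nseq 5 x ++ w2).
  exact: cf_weights_cons C3 _ _.
have PE : (pell k.*2.+3)%:Z = 24 * s + 5 * r by rewrite !pellSS; lia.
have HE : (hpell k.*2.+4)%:Z = 82 * s + 17 * r by rewrite !hpellSS; lia.
have [Q0 QS S1 hw] := cf_weights_bounds C1.
have xE : x = 2 * (24 * s + 5 * r) ^+ 2 by rewrite /x SE QE; ring.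
have yE : 5 * x + y = (82 * s + 17 * r) ^+ 2 by rewrite /y xE; lia.
set d : int := (24 * s + 5 * r) * (82 * s + 17 * r).
have oddn : odd k.*2.+3 by rewrite /= odd_double.
apply: (in_calE_alpha (d := d) C4) => //.
- by rewrite /= /ls last_iter_cf14 //= last_iter_cf14.
- by rewrite /alpha oddn yE xE !(rmorphM, rmorphXn) /= -PE -HE -!pmulrn.
- by rewrite oddn PoszM PE HE.
(* This condition is inhomogeneous in [s] and [r], so it rests on [det]. *)
- by rewrite yE xE /d; lia.
- by rewrite yE xE /d; ring.
set c : int := d - x.
have cE : 2 * (c + c) = 2 * x + y + 2 * 0 + 1 by rewrite /c /d; lia.
have -> : 2 * d - x = c + c + x + 0 by lia.
apply: (@reduces_perm _ (nseq 4 x ++ w2 ++ [:: c, c & [:: 1]])).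
  perm_count.
have xb : 9 * (s + r) <= 5 * S + 4 * Q by lia.
have hw' : all (fun t => t <= 5 * S + 4 * Q) w by apply: sub_all hw => t; lia.
apply: (reduces_chain _ _ _ _ _ _ _ E2 EX xb) => //; try lia.
  by rewrite /= hw'; lia.
move=> d1 d2 dd dE.
(* The difference [d1 - d2] is still 0, and [dE] gives the sum. *)
have -> : d1 = 168 * s + 35 * r by lia.
have -> : d2 = 168 * s + 35 * r by lia.
have -> : 168 * s + 35 * r + (168 * s + 35 * r) + (5 * S + 4 * Q) + s =
  578 * s + 120 * r by lia.
exact: reduces_odd_end SE QE C1 pX.
Qed.

(* alpha_{2k+4} = [5; (1, 4)^(k+1), 1, 1, 3, (1, 4)^k, 1, 5]. *)
Lemma in_calE_alpha_even k : in_calE (E_alpha k.*2.+4).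
Proof.
have [s [r [[s0 r0 det] [[p0 p1 h0 h1] [Hw HX]]]]] := pell_coordinates k.
have [w Ew] := Hw 6 5 [:: 5, 1 & nseq 4 1].
have [X {}HX] := HX 0 1 [:: 1].
have EX : iter k residue14 (0, 1, [:: 1]) = (s, r, X).
  by rewrite HX; congr (_, _, _); lia.
have [] := cf14_residue14_perm EX Ew.
(* The run before the middle is one period longer than the run after it, hence one more residue. *)
have {}EX : iter k.+1 residue14 (0, 1, [:: 1]) =
  (5 * s + r, 4 * s + r, 4 * s + r :: nseq 4 (5 * s + r) ++ X).
  by rewrite iterS EX.
move: Ew; set S := _ + 5 * s; set Q := _ + r * 5 => Ew SE QE pX.
have C0 : cf_weights [:: 1; 5]%N 6 5 [:: 5, 1 & nseq 4 1].
  exact: (CfCons (l := 1) isT (CfCons (l := 5) isT CfNil)).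
have C1 := cf_weights_cf14 C0 Ew.
have C2 : cf_weights [:: 1, 1, 3 & iter k (fun l => [:: 1, 4 & l]%N) [:: 1; 5]%N]
    (7 * S + 2 * Q) (4 * S + Q)
    ([:: 4 * S + Q, 3 * S + Q, S, S, S & w]).
  have C3 : cf_weights (3%N :: iter k (fun l => [:: 1, 4 & l]%N) [:: 1; 5]%N)
    (3 * S + Q) S (nseq 3 S ++ w) by apply: cf_weights_cons C1 _ _ => //; lia.
  have C4 : cf_weights [:: 1, 3 & iter k (fun l => [:: 1, 4 & l]%N) [:: 1; 5]%N]
    (4 * S + Q) (3 * S + Q) (3 * S + Q :: nseq 3 S ++ w).
    by apply: cf_weights_cons C3 _ _ => //; lia.
  by apply: cf_weights_cons C4 _ _ => //; lia.
(* [Hw] covers [k] iterates, so it is applied after a first step written out by hand. *)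
have [w2 E2] := Hw (5 * (7 * S + 2 * Q) + (4 * S + Q))
  (4 * (7 * S + 2 * Q) + (4 * S + Q))
  (4 * (7 * S + 2 * Q) + (4 * S + Q) :: nseq 4 (7 * S + 2 * Q) ++
  [:: 4 * S + Q, 3 * S + Q, S, S, S & w]).
move: E2; set x := _ + _ * s; set y := _ + r * _ => E2.
have {}E2 : iter k.+1 cf14
    (7 * S + 2 * Q, 4 * S + Q, [:: 4 * S + Q, 3 * S + Q, S, S, S & w]) = (x, y, w2).
  by rewrite iterSr.
have C3 := cf_weights_cf14 C2 E2.
set ls := iter k.+1 _ _ in C3.
have C4 : cf_weights (5%N :: ls) (5 * x + y) x (nseq 5 x ++ w2).
  exact: cf_weights_cons C3 _ _.
have PE : (pell k.*2.+4.+1)%:Z = 140 * s + 29 * r by rewrite !pellSS; lia.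
have HE : (hpell k.*2.+4)%:Z = 82 * s + 17 * r by rewrite !hpellSS; lia.
have [Q0 QS S1 hw] := cf_weights_bounds C1.
have xE : x = (82 * s + 17 * r) ^+ 2 by rewrite /x SE QE; ring.
have yE : 5 * x + y = 2 * (140 * s + 29 * r) ^+ 2 by rewrite /y xE; lia.
set d : int := (140 * s + 29 * r) * (82 * s + 17 * r).
have oddn : odd k.*2.+4 = false by rewrite /= odd_double.
apply: (in_calE_alpha (d := d) C4) => //.
- by rewrite /= /ls last_iter_cf14 //= last_iter_cf14.
- by rewrite /alpha oddn yE xE !(rmorphM, rmorphXn) /= -PE -HE -!pmulrn.
- by rewrite oddn PoszM PE HE.
- by rewrite yE xE /d; lia.
- by rewrite yE xE /d; ring.
set c : int := d - x.
have cE : 2 * (c + c) = 2 * x + y + 2 * 0 + 1 by rewrite /c /d; lia.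
have -> : 2 * d - x = c + c + x + 0 by lia.
apply: (@reduces_perm _ (nseq 4 x ++ w2 ++ [:: c, c & [:: 1]])).
  perm_count.
have xb : 9 * (5 * s + r + (4 * s + r)) <= 7 * S + 2 * Q by lia.
have hw' : all (fun t => t <= 7 * S + 2 * Q) w by apply: sub_all hw => t; lia.
apply: (reduces_chain _ _ _ _ _ _ _ E2 EX xb) => //; try lia.
  by rewrite /= hw'; lia.
move=> d1 d2 dd dE.
have -> : d1 = 4 * S + 2 * Q by lia.
have -> : d2 = 4 * S + 2 * Q by lia.
have -> : 4 * S + 2 * Q + (4 * S + 2 * Q) + (7 * S + 2 * Q) + (5 * s + r) =
  16 * S + 5 * Q by lia.
exact: reduces_even_end C1 pX.
Qed.

(* beta_{2k+1} = [5; (1, 4)^k]. *)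
Lemma in_calE_beta_odd k : in_calE (E_beta k.*2.+1).
Proof.
have [s [r [[s0 r0 det] [[p0 p1 h0 h1] [Hw HX]]]]] := pell_coordinates k.
have [w Ew] := Hw 1 0 [::].
have {}Ew : iter k cf14 (1, 0, [::]) = (4 * s + r, 4 * s, w).
  by rewrite Ew; congr (_, _, _); lia.
have C1 := cf_weights_cf14 CfNil Ew.
set x : int := 4 * s + r in Ew C1.
have C2 : cf_weights (5%N :: iter k (fun l => [:: 1, 4 & l]%N) [::])
  (5 * x + 4 * s) x (nseq 5 x ++ w) by exact: cf_weights_cons C1 _ _.
have PE : (pell k.*2.+3)%:Z = 5 * x + 4 * s by rewrite !pellSS; lia.
have oddn : odd k.*2.+1 by rewrite /= odd_double.
(* An even [r] would make the left side of [det] divisible by 4. Oddness makes [d] and [e]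
   integers. *)
have [t rE] : exists t : int, r = 2 * t + 1.
  exists (r %/ 2)%Z.
  have [rE|rE] : r = 2 * (r %/ 2)%Z \/ r = 2 * (r %/ 2)%Z + 1 by lia.
    by move: det; rewrite rE; lia.
  by [].
apply: (in_calE_beta (d := 7 * s + 3 * t + 2) (e := 7 * s + 3 * t + 1) C2) => //;
  rewrite ?oddn; try lia.
- by rewrite /= last_iter_cf14_nil; case: (k).
- by rewrite /beta oddn -PE /x -p1 -!pmulrn.
set c1 : int := 7 * s + 3 * t + 2 - x; set c2 : int := 7 * s + 3 * t + 1 - x.
apply: (@reduces_perm _ (nseq 4 x ++ w ++ [:: c1, c2 & [::]])).
  perm_count.
case EX : (iter k residue14 (0, 0, [::])) => [[s' r'] X].
have [s'0 r'0 X0] := residue14_zero EX.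
have -> : 7 * s + 3 * t + 2 + (7 * s + 3 * t + 1) - x = c1 + c2 + x + 0 by lia.
apply: (reduces_chain _ _ _ _ _ _ _ Ew EX) => //; try lia.
move=> d1 d2 dd dE.
(* The chain ends at the trivial fraction 1 / 0, with [d1 + d2 = 1] and [d1 - d2 = 1]. *)
have -> : d1 = 1 by lia.
have -> : d2 = 0 by lia.
rewrite s'0 /=; apply: (@reduces_perm _ [:: 1 : int, 1, 1, 1, 1, 0 : int & X]).
  perm_count.
have hX v : 0 <= v -> all (fun t => t <= v) X.
  by move=> v0; apply: sub_all X0 => u /eqP ->.
apply: reduces_step; [lia|lia|by rewrite /= hX|].
apply: reduces_perm (cf_weights_reduces (z := [:: 0, 0, 0 & X]) CfNil _) => //.
have -> : 1 + 0 + 1 + 0 - 1 - 1 = 0 :> int by lia.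
perm_count.
Qed.

(* beta_{2k+2} = [5; (1, 4)^k, 1, 2]. *)
Lemma in_calE_beta_even k : in_calE (E_beta k.*2.+2).
Proof.
have [s [r [[s0 r0 det] [[p0 p1 h0 h1] [Hw HX]]]]] := pell_coordinates k.
have [w Ew] := Hw 3 2 [:: 2, 1 & [:: 1]].
have {}Ew : iter k cf14 (3, 2, [:: 2, 1 & [:: 1]]) =
    (14 * s + 3 * r, 12 * s + 2 * r, w).
  by rewrite Ew; congr (_, _, _); lia.
have C0 : cf_weights [:: 1; 2]%N 3 2 [:: 2, 1 & [:: 1]].
  exact: (CfCons (l := 1) isT (CfCons (l := 2) isT CfNil)).
have C1 := cf_weights_cf14 C0 Ew.
set x : int := 14 * s + 3 * r in Ew C1.
have C2 : cf_weights (5%N :: iter k (fun l => [:: 1, 4 & l]%N) [:: 1; 2]%N)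
  (5 * x + (12 * s + 2 * r)) x (nseq 5 x ++ w) by exact: cf_weights_cons C1 _ _.
have HE : (hpell k.*2.+2)%:Z = x by rewrite !hpellSS; lia.
have HE' : (hpell k.*2.+4)%:Z = 5 * x + (12 * s + 2 * r) by rewrite !hpellSS; lia.
have oddn : odd k.*2.+2 = false by rewrite /= odd_double.
apply: (in_calE_beta (d := 24 * s + 5 * r) (e := 24 * s + 5 * r) C2) => //;
  rewrite ?oddn; try lia.
- by rewrite /= last_iter_cf14.
- by rewrite /beta oddn -HE' -HE -!pmulrn.
set c : int := 24 * s + 5 * r - x.
apply: (@reduces_perm _ (nseq 4 x ++ w ++ [:: c, c & [::]])).
  perm_count.
case EX : (iter k residue14 (0, 0, [::])) => [[s' r'] X].
have [s'0 r'0 X0] := residue14_zero EX.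
have -> : 24 * s + 5 * r + (24 * s + 5 * r) - x = c + c + x + 0 by lia.
apply: (reduces_chain _ _ _ _ _ _ _ Ew EX) => //; try lia.
move=> d1 d2 dd dE.
have -> : d1 = (2 : int) by lia.
have -> : d2 = (2 : int) by lia.
have hX v : 0 <= v -> all (fun t => t <= v) X.
  by move=> v0; apply: sub_all X0 => u /eqP ->.
(* The weights 2, 1, 1 of 3 / 2 and [d1 = d2 = 2] allow one more block, with [a = 3] and
   [b = c1 = c2 = 2]. *)
rewrite s'0; apply: (@reduces_perm _
  (nseq 4 (3 : int) ++ [:: 2 : int, 2 : int, 2 : int, 1, 1 & X])).
  perm_count.
apply: reduces_block => //; first by rewrite /= hX.
change (reduces_to_E (1 : int, nseq 7 (0 : int) ++ [:: 1, 1 & X])).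
apply: reduces_perm (cf_weights_reduces (z := nseq 6 0 ++ X) CfNil _) => //.
perm_count.
Qed.

(** * Small indices and conclusion *)

Lemma in_calE_small : [/\ in_calE (E_alpha 0), in_calE (E_alpha 1),
  in_calE (E_alpha 2) & in_calE (E_beta 0)].
Proof.
split.
- have C : cf_weights [:: 2]%N 2 1 (nseq 2 1 ++ [::]).
    exact: (CfCons (l := 2) isT CfNil).
  apply: (in_calE_alpha (d := 1) C) => //.
  by apply: reduces_perm (cf_weights_reduces (z := [:: 0]) CfNil _).
- have C : cf_weights [:: 4; 2]%N 9 2 (nseq 4 2 ++ [:: 1; 1]).
    exact: (CfCons (l := 4) isT (CfCons (l := 2) isT CfNil)).
  apply: (in_calE_alpha (d := 3) C) => //.
  apply: (@reduces_perm _ [:: 2; 2; 2; 1; 1; 1; 1; 1]) => //.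
  apply: reduces_step => //.
  apply: (@reduces_perm _ [:: 1; 1; 1; 1; 1; 0; 0; 0]) => //.
  apply: reduces_step => //.
  by apply: reduces_perm (cf_weights_reduces (z := nseq 5 0) CfNil _).
(* Reading [5; 1, 1, 4] as [5; 1, 1, 3, 1] gives the even middle with [s = r = 1]; the final
   quotient 1 is legitimate in [cf_weights]. *)
- have C' : cf_weights [:: 1]%N 1 1 [:: 1] by exact: (CfCons (l := 1) isT CfNil).
  have C : cf_weights [:: 5; 1; 1; 4]%N 50 9 (nseq 5 9 ++ [:: 5; 4; 1; 1; 1; 1]).
    exact: (CfCons (l := 5) isT (CfCons (l := 1) isT
      (CfCons (l := 1) isT (CfCons (l := 4) isT CfNil)))).
  apply: (in_calE_alpha (d := 15) C) => //.
  by apply: reduces_perm (reduces_even_end (X := [:: 1]) C' isT).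
- have C : cf_weights [:: 3]%N 3 1 (nseq 3 1 ++ [::]).
    exact: (CfCons (l := 3) isT CfNil).
  apply: (in_calE_beta (d := 1) (e := 1) C) => //.
  by apply: reduces_perm (cf_weights_reduces (z := [:: 0]) CfNil _).
Qed.

Theorem theorem5p1 (n : nat) : in_calE (E_alpha n) /\ in_calE (E_beta n).
Proof.
have [a0 a1 a2 b0] := in_calE_small.
rewrite -[n]odd_double_half; case: (odd n) => /=; rewrite ?add0n ?add1n.
  by split; last exact: in_calE_beta_odd; case: n./2 => [//|k];
    exact: in_calE_alpha_odd.
by split; case: n./2 => [|[|k]] //; [exact: in_calE_alpha_even|
  exact: (in_calE_beta_even 0)|exact: (in_calE_beta_even k.+1)].
Qed.
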